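(* Let $B_0,\dots,B_N$ be complex $m\times m$ matrices, let $b_0=0$ and let $b_1,\dots,b_N\in\mathbb{C}\setminus\{0\}$ be mutually distinct, let $\lambda\in\mathbb{C}$, and let $K_\lambda(x,s)$ be a function satisfying $$q^{\lambda}K_\lambda(qx,s)=K_\lambda(x,s/q)=\frac{x-q^{\lambda}s}{x-s}K_\lambda(x,s).$$ Let $Y(x)$ be a $\mathbb{C}^m$-valued solution to $$\frac{Y(qx)-Y(x)}{-x}=\Biggl[\sum_{i=0}^{N}\frac{B_i}{x-b_i}\Biggr]Y(x),$$ let $\xi\ne0$ be independent of $x$ or proportional to $x$ (i.e. $\xi=Ax$ with $A$ independent of $x$), and set $$\widetilde Y_i(x)=\int_0^{\xi\infty}\frac{K_\lambda(x,s)}{s-b_i}Y(s)\,{\rm d}_qs\quad(i=0,\dots,N),\qquad \widetilde Y(x)=\begin{pmatrix}\widetilde Y_0(x)\\ \vdots\\ \widetilde Y_N(x)\end{pmatrix}.$$ Assume that the integrand of $\widetilde Y_i(x)$ is well defined (i.e. does not diverge) at $s=q^n\xi$ for any $i\in\{0,1,\dots,N\}$ and $n\in\mathbb{Z}$. If the absolute value of any eigenvalue of $I_m-B_0$ is strictly less than $1$ and the absolute value of any eigenvalue of $I_m-B_0-B_1-\dots-B_N$ is strictly more than $|q^{\lambda}|$, then $\widetilde Y(x)$ converges and it satisfies $$\frac{\widetilde Y(qx)-\widetilde Y(x)}{-x}=\Biggl[\sum_{i=0}^{N}\frac{G_i}{x-b_i}\Biggr]\widetilde Y(x),$$ where $(G_0,\dots,G_N)$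 is the $q$-convolution with parameter $\lambda$ of $(B_0,\dots,B_N)$.
   Context: Throughout, $q\in\mathbb{C}$ with $0<|q|<1$; a value of $\log q$ is fixed and $q^{a}=\exp(a\log q)$. Jackson integral: for $\xi\in\mathbb{C}\setminus\{0\}$, $\int_0^{\xi\infty}f(s)\,{\rm d}_qs=(1-q)\sum_{n=-\infty}^{\infty}q^n\xi f(q^n\xi)$ (applied componentwise to vector-valued functions). $q$-convolution: given $m\times m$ matrices $B_0,\dots,B_N$ and $\lambda\in\mathbb{C}$, the $q$-convolution is the tuple $(G_0,\dots,G_N)$ of $(N+1)m\times(N+1)m$ matrices, where $G_i$, viewed as an $(N+1)\times(N+1)$ array of $m\times m$ blocks with rows and columns indexed by $0,\dots,N$, has all block rows zero except row $i$, and its $(i,j)$ block is $q^{-\lambda}B_j$ for $j\ne i$ and $q^{-\lambda}B_i+(1-q^{-\lambda})I_m$ for $j=i$. *)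

(* Defs.v *)
From HB Require Import structures.
From mathcomp Require Import all_boot all_order all_algebra.
From mathcomp Require Import all_classical all_reals all_analysis.
From mathcomp Require Import complex.

Set Implicit Arguments.
Unset Strict Implicit.
Unset Printing Implicit Defensive.

Import Order.TTheory GRing.Theory Num.Theory.
Import numFieldNormedType.Exports.
Local Open Scope classical_set_scope.
Local Open Scope ring_scope.

(* The complex numbers over [R], seen through [numClosedFieldType] because
   MathComp-Analysis puts the norm topology on the carrier of an abstract
   [numClosedFieldType] but not on the concrete type [R[i]].  [`|z|] is the
   modulus, as a (real) complex number. *)
Definition Cplx (R : realType) : numClosedFieldType := R[i].

Definition cexp (R : realType) (z : Cplx R) : Cplx R :=
  let: Complex a b := (z : R[i]) in Complex (expR a * cos b) (expR a * sin b).

(* [q ^ a], for the value [logq] of the logarithm of [q]. *)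
Definition qpow (R : realType) (logq a : Cplx R) : Cplx R := cexp (a * logq).

Section QConvolution.
Variable C : numClosedFieldType.

(* A bilateral series converges when both of its halves do; this is stronger
   than convergence of the symmetric partial sums. *)
Definition bilateral_cvg (u : int -> C) : Prop :=
  cvgn (series (fun n : nat => u n%:Z)) /\
  cvgn (series (fun n : nat => u (- n.+1%:Z))).

Definition bilateral_sum (u : int -> C) : C :=
  limn (series (fun n : nat => u n%:Z)) +
  limn (series (fun n : nat => u (- n.+1%:Z))).

Definition jackson_term (q xi : C) (f : C -> C) (n : int) : C :=
  q ^ n * xi * f (q ^ n * xi).

Definition jackson_cvg (q xi : C) (f : C -> C) : Prop :=
  bilateral_cvg (jackson_term q xi f).

Definition jackson (q xi : C) (f : C -> C) : C :=
  (1 - q) * bilateral_sum (jackson_term q xi f).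

(* The system (Y(qx) - Y(x)) / (-x) = [sum_i A_i / (x - b_i)] Y(x) at [x];
   meaningful for [x] distinct from 0 and from all the [b i]. *)
Definition q_system_at (n N : nat) (q : C) (b : 'I_N.+1 -> C)
    (A : 'I_N.+1 -> 'M[C]_n) (Y : C -> 'cV[C]_n) (x : C) : Prop :=
  (- x)^-1 *: (Y (q * x) - Y x) =
  (\sum_(i < N.+1) (x - b i)^-1 *: A i) *m Y x.

(* [qml] stands for [q ^ (- lambda)]. *)
Definition q_convolution (m N : nat) (qml : C) (B : 'I_N.+1 -> 'M[C]_m)
    (i : 'I_N.+1) : 'M[C]_(\sum_(k < N.+1) m) :=
  \mxblock_(k < N.+1, j < N.+1)
    (if k == i then
       if j == i then qml *: B i + (1 - qml)%:M else qml *: B j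
     else 0 : 'M[C]_m).

Section Transform.
Variables (m N : nat) (q : C) (b : 'I_N.+1 -> C).
(* [K] and [Y] are partial functions: their values outside [domK], [domY]
   (at poles, say) carry no meaning. *)
Variables (K : C -> C -> C) (domK : C -> C -> Prop).
Variables (Y : C -> 'cV[C]_m) (domY : C -> Prop).

Definition integrand (i : 'I_N.+1) (x s : C) : 'cV[C]_m :=
  (K x s / (s - b i)) *: Y s.

(* [approach s0] is the filter along which the integrand is evaluated at [s0].
   For [principal_filter] the value is the plain one, and well-definedness
   says that [K x] and [Y] are defined at [s0] and that [s0] is none of the
   [b i].  For [dnbhs] (punctured neighbourhoods) the value is the limit at
   [s0]; this is the usual value of a meromorphic integrand and it allows
   removable singularities of the product, as when a zero of [Y] or [K x]
   cancels the pole of [1 / (s - b i)]. *)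
Variable approach : C -> set_system C.

Definition integrand_value (i : 'I_N.+1) (x : C) (k : 'I_m) (s0 : C) : C :=
  lim (integrand i x s k 0 @[s --> approach s0]).

Definition integrand_well_defined (x xi : C) : Prop :=
  forall n : int,
    (\forall s \near approach (q ^ n * xi),
       [/\ domK x s, domY s & forall i, s != b i]) /\
    (forall (i : 'I_N.+1) (k : 'I_m),
       cvg (integrand i x s k 0 @[s --> approach (q ^ n * xi)])).

Definition q_transform_cvg (x xi : C) : Prop :=
  forall (i : 'I_N.+1) (k : 'I_m), jackson_cvg q xi (integrand_value i x k).

Definition q_transform (x xi : C) : 'cV[C]_(\sum_(i < N.+1) m) :=
  \mxcol_(i < N.+1) \col_(k < m) jackson q xi (integrand_value i x k).

End Transform.
End QConvolution.

(* Main.v *)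
Require Import Defs.
From HB Require Import structures.
From mathcomp Require Import all_boot all_order all_algebra.
From mathcomp Require Import all_classical all_reals all_analysis.
From mathcomp Require Import complex.
From mathcomp Require Import ring spectral.

Set Implicit Arguments.
Unset Strict Implicit.
Unset Printing Implicit Defensive.

Import Order.TTheory GRing.Theory Num.Theory.
Import numFieldNormedType.Exports.
Local Open Scope classical_set_scope.
Local Open Scope ring_scope.

(** Write [W_i(x, s) = s K(x, s) Y(s) / (s - b_i)], so that the transform is
    [1 - q] times the sum of the values of [W_i(x, .)] over the lattice
    [q^n xi].  Since [b_0 = 0], [W_0 = K Y] and [W_i = s / (s - b_i) W_0].

    Convergence.  The equations of [Y] and [K] combine into
      [(x - q^lambda q s) W_0(x, q s) = (x - q s) (W_0 - sum_j B_j W_j)(x, s)]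
    ([weighted_step]).  Near [s = 0] this is a small perturbation of
    [v' = (1 - B_0) v]; near infinity, read backwards, it is a small
    perturbation of [v' = q^lambda (1 - sum_j B_j)^-1 v].  The two eigenvalue
    hypotheses say exactly that these limit matrices have spectral radius below
    one, so the terms decay geometrically at both ends of the lattice
    ([recurrence_decay], [forward_decay], [backward_decay]).

    The system.  Two identities with coefficients that do not depend on [s]
    hold pointwise:
      [W_0(x, s) - q^lambda W_0(q x, q s) = sum_j B_j W_j(x, s)]
    ([weighted_shift]), and
      [(x - b_i) (W_i(q x, s) - W_i(x, s))
        = x W_0(q x, s) - q^-lambda x W_0(x, s) + (q^-lambda - 1) x W_i(x, s)]
    ([weighted_contiguity]).  They are summed over the lattice, where the sum of
    [W_0(q x, q s)] is that of [W_0(q x, s)] by invariance under a shift of the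
    index; eliminating the sum of [W_0(q x, .)] between the two results leaves
    the system of the q-convolution ([sum_system]).  The same invariance
    identifies the sums over the lattices of [xi] and [q xi], which settles the
    case of [xi] proportional to [x].

    The value of the integrand at a lattice point is its limit along a filter,
    so every pointwise identity is first proved near that filter and then passed
    to the limit ([entrywise_cvg_unique]).  What this uses of the
    filter is that it is proper, finer than the neighbourhoods, and compatible
    with homotheties.  The field is kept abstract, with a single completeness
    assumption, and specialized to the complex numbers at the end. *)

(** * Linear recurrences whose limit matrix has spectral radius below one *)

Section Contraction.
Variable C : numClosedFieldType.

(** The order of [C] is partial, hence a product in the place of a maximum. *)
Lemma uniform_lt1_bound (n : nat) (a : 'I_n -> C) :
  (forall j, 0 <= a j < 1) -> exists2 r, 0 <= r < 1 & forall j, a j <= r.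
Proof.
move=> a01; exists (1 - \prod_j (1 - a j)).
  have p01 : 0 < \prod_j (1 - a j) <= 1.
    elim/big_ind: _ => [|x y /andP[x0 x1] /andP[y0 y1]|j _].
    - by rewrite ltr01 lexx.
    - by rewrite mulr_gt0//= mulr_ile1// ltW.
    - by have /andP[? ?] := a01 j; rewrite subr_gt0 gerBl; apply/andP.
  by rewrite subr_ge0 gtrBl andbC.
move=> j; rewrite lerBrDr -lerBrDl (bigD1 j)//=.
have /andP[j0 j1] := a01 j.
rewrite ler_piMr// ?subr_ge0 ?(ltW j1)//.
suff /andP[] : 0 <= \prod_(i < n | i != j) (1 - a i) <= 1 by [].
elim/big_ind: _ => [|x y /andP[x0 x1] /andP[y0 y1]|i _].
- by rewrite ler01 lexx.
- by rewrite mulr_ge0//= mulr_ile1.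
- by have /andP[? ?] := a01 i; rewrite subr_ge0 gerBl ltW//=.
Qed.

(** A triangular conjugate of [M] has the eigenvalues on its diagonal, and a
    further conjugation by the diagonal matrix of the powers of a small [d]
    multiplies the off-diagonal entries by positive powers of [d], so that in
    the new basis [M] contracts the l1 norm. *)
Lemma spectral_radius_lt1_contracting_basis (n : nat) (M : 'M[C]_n) :
  (forall a, eigenvalue M a -> `|a| < 1) ->
  exists2 P, P \in unitmx &
  exists2 r, 0 <= r < 1 & forall j, \sum_i `|(P *m M *m invmx P) i j| <= r.
Proof.
case: n M => [|n] M Mlt1.
  by exists 1%:M; rewrite ?unitmx1//; exists 0; rewrite ?lexx ?ltr01// => -[].
have [U Uunitary] := Schur M (ltn0Sn n).
have Uunit := unitarymx_unit Uunitary.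
rewrite /similar_to/= conjymx// -invmx_unitary//.
move TE : (_ *m _ *m _) => T Ttrig.
have Tdiag j : 0 <= `|T j j| < 1.
  rewrite normr_ge0/= Mlt1//.
  have := @eigenvalue_conjmx C _ _ U M; rewrite stablemx_unit//; move=> /(_ isT).
  rewrite row_free_unit => /(_ Uunit); apply.
  rewrite conjymx// -invmx_unitary// TE /in_mem/=.
  rewrite eigenvalue_root_char char_poly_trig// /root horner_prod.
  by rewrite (bigD1 j)//= hornerXsubC subrr mul0r.
have [r /andP[r0 r1] Tr] := @uniform_lt1_bound _ (fun j => `|T j j|) Tdiag.
pose S := \sum_i \sum_j `|T i j|.
have S0 : 0 <= S by apply: sumr_ge0 => i _; apply: sumr_ge0.
(* [d S <= (1 - r) / 2]: the off-diagonal part of a column takes at most half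
   of the room left below [1] by the diagonal. *)
pose d := (1 - r) / 2 / (1 + S).
have S1 : 0 < 1 + S by rewrite ltr_pwDl.
have d0 : 0 < d by rewrite divr_gt0// divr_gt0// subr_gt0.
have dS : d * S <= (1 - r) / 2.
  rewrite /d -mulrA ler_piMr//; first by rewrite divr_ge0// subr_ge0 ltW.
  by rewrite ler_pdivrMl// mulr1 lerDr.
have d1 : d <= 1.
  rewrite /d ler_pdivrMr// mul1r (@le_trans _ _ 1)// ?lerDl//.
  by rewrite ler_pdivrMr// mul1r (@le_trans _ _ 1)// ?ler1n// gerBl.
pose D : 'M[C]_n.+1 := diag_mx (\row_i d ^+ i).
pose D' : 'M[C]_n.+1 := diag_mx (\row_i d ^- i).
have DD' : D *m D' = 1%:M.
  rewrite mulmx_diag; apply/matrixP => i j; rewrite !mxE.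
  by rewrite mulfV// expf_neq0// gt_eqF.
have [Dunit _] := mulmx1_unit DD'.
have invD : invmx D = D' by rewrite -[D']mul1mx -(mulVmx Dunit) -mulmxA DD' mulmx1.
have invDU : invmx (D *m U) = invmx U *m D'.
  rewrite -[RHS]mul1mx -(@mulVmx _ _ (D *m U)) ?unitmx_mul ?Dunit//.
  by rewrite -!mulmxA (mulmxA U) mulmxV// mul1mx DD' mulmx1.
exists (D *m U); first by rewrite unitmx_mul Dunit.
exists (r + (1 - r) / 2).
  apply/andP; split; first by rewrite addr_ge0// divr_ge0// subr_ge0 ltW.
  rewrite -subr_gt0 (_ : 1 - _ = (1 - r) / 2); last by field.
  by rewrite divr_gt0// subr_gt0.
move=> j; rewrite invDU !mulmxA -2!(mulmxA D) TE.
have entry i : `|(D *m T *m D') i j| <= (if i == j then r else 0) + d * `|T i j|.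
  rewrite mul_diag_mx mul_mx_diag !mxE.
  have [ij|ji|/val_inj ->] := ltngtP i j.
  - rewrite (is_trig_mxP Ttrig)// mulr0 mul0r normr0 addr_ge0//.
      by case: ifP.
    by rewrite mulr_ge0// ltW.
  - rewrite -val_eqE gtn_eqF// add0r.
    rewrite mulrAC normrM ler_wpM2r// -exprB//; last 2 first.
    + exact: ltnW.
    + by rewrite unitfE gt_eqF.
    rewrite ger0_norm ?exprn_ge0 ?(ltW d0)//.
    rewrite -(subnSK ji) exprS; apply: ler_piMr (ltW d0) _.
    exact: exprn_ile1 (ltW d0) d1.
  - rewrite eqxx mulrAC mulfV ?expf_neq0 ?gt_eqF// mul1r.
    by rewrite (le_trans (Tr j))// lerDl mulr_ge0// ltW.
apply: le_trans (ler_sum _ (fun i _ => entry i)) _.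
rewrite big_split/= -big_mkcond/= big_pred1_eq lerD2l -mulr_sumr.
apply: le_trans dS; rewrite ler_pM2l// /S; apply: ler_sum => i _.
by rewrite (bigD1 j)//= lerDl sumr_ge0.
Qed.

Definition l1 (n : nat) (v : 'cV[C]_n) : C := \sum_i `|v i 0|.

Lemma ler_l1D (n : nat) (u v : 'cV[C]_n) : l1 (u + v) <= l1 u + l1 v.
Proof.
by rewrite /l1 -big_split/=; apply: ler_sum => i _; rewrite mxE ler_normD.
Qed.

Lemma ler_norm_l1 (n : nat) (v : 'cV[C]_n) i : `|v i 0| <= l1 v.
Proof. by rewrite /l1 (bigD1 i)//= lerDl sumr_ge0. Qed.

Lemma ler_l1_mulmx (m n : nat) (A : 'M[C]_(m, n)) (r : C) (v : 'cV[C]_n) :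
  (forall j, \sum_i `|A i j| <= r) -> l1 (A *m v) <= r * l1 v.
Proof.
move=> Ar; rewrite /l1 mulr_sumr.
apply: (@le_trans _ _ (\sum_i \sum_j `|A i j| * `|v j 0|)).
  apply: ler_sum => i _; rewrite mxE (le_trans (ler_norm_sum _ _ _))//.
  by apply: ler_sum => j _; rewrite normrM.
rewrite exchange_big/=; apply: ler_sum => j _.
by rewrite -mulr_suml ler_wpM2r.
Qed.

(** The limits of entries are what the sums and the integrand values are made
    of, so this form needs no norm on matrices. *)
Definition entrywise_cvg (T : Type) (F : set_system T) (m n : nat)
    (H : T -> 'M[C]_(m, n)) (L : 'M[C]_(m, n)) :=
  forall i j, H t i j @[t --> F] --> L i j.

Section EntrywiseLimits.
Context {T : Type} {F : set_system T} {FF : ProperFilter F}.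

Lemma entrywise_cvg_cst (m n : nat) (A : 'M[C]_(m, n)) :
  entrywise_cvg F (fun=> A) A.
Proof. by move=> i j; exact: cvg_cst. Qed.

Lemma entrywise_cvgD (m n : nat) (H H' : T -> 'M[C]_(m, n)) L L' :
  entrywise_cvg F H L -> entrywise_cvg F H' L' ->
  entrywise_cvg F (fun k => H k + H' k) (L + L').
Proof.
move=> HL HL' i j; rewrite mxE; under eq_cvg do rewrite mxE.
by apply: cvgD; [exact: HL|exact: HL'].
Qed.

Lemma entrywise_cvg_sum (m n : nat) (I : Type) (s : seq I) (P : pred I)
    (H : I -> T -> 'M[C]_(m, n)) L :
  (forall i, P i -> entrywise_cvg F (H i) (L i)) ->
  entrywise_cvg F (fun k => \sum_(i <- s | P i) H i k) (\sum_(i <- s | P i) L i).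
Proof.
move=> HL; elim: s => [|a s IH].
  by under eq_fun do rewrite big_nil; rewrite big_nil; exact: entrywise_cvg_cst.
under eq_fun do rewrite big_cons; rewrite big_cons.
by case: ifP => // Pa; apply: entrywise_cvgD => //; exact: HL.
Qed.

Lemma entrywise_cvgZ (m n : nat) (a : T -> C) (l : C) H (L : 'M[C]_(m, n)) :
  a k @[k --> F] --> l -> entrywise_cvg F H L ->
  entrywise_cvg F (fun k => a k *: H k) (l *: L).
Proof.
move=> al HL i j; rewrite mxE; under eq_cvg do rewrite mxE.
by apply: cvgM => //; exact: HL.
Qed.

Lemma entrywise_cvgB (m n : nat) (H H' : T -> 'M[C]_(m, n)) L L' :
  entrywise_cvg F H L -> entrywise_cvg F H' L' ->
  entrywise_cvg F (fun k => H k - H' k) (L - L').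
Proof.
move=> HL HL'; rewrite -scaleN1r; under eq_fun do rewrite -scaleN1r.
by apply: entrywise_cvgD => //; apply: entrywise_cvgZ => //; exact: cvg_cst.
Qed.

Lemma entrywise_cvgM (m n p : nat) (H : T -> 'M[C]_(m, n)) L
    (H' : T -> 'M[C]_(n, p)) L' :
  entrywise_cvg F H L -> entrywise_cvg F H' L' ->
  entrywise_cvg F (fun k => H k *m H' k) (L *m L').
Proof.
move=> HL HL' i j; rewrite mxE; under eq_cvg do rewrite mxE.
have S (s : seq 'I_n) :
    \sum_(k <- s) H t i k * H' t k j @[t --> F] --> \sum_(k <- s) L i k * L' k j.
  elim: s => [|a s IH].
    by under eq_fun do rewrite big_nil; rewrite big_nil; exact: cvg_cst.
  under eq_fun do rewrite big_cons; rewrite big_cons.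
  by apply: cvgD => //; apply: cvgM; [exact: HL|exact: HL'].
exact: S.
Qed.

Lemma entrywise_cvg_unique (m n : nat) (H H' : T -> 'M[C]_(m, n)) L L' :
  (\forall t \near F, H t = H' t) -> entrywise_cvg F H L ->
  entrywise_cvg F H' L' -> L = L'.
Proof.
move=> HH' HL HL'; apply/matrixP => i j.
apply: (cvg_unique (@norm_hausdorff C C) (HL i j)); apply: cvg_trans (HL' i j).
apply: near_eq_cvg; apply: filterS HH' => t /= -> //.
Qed.

End EntrywiseLimits.

Lemma near_column_sum_le (m n : nat) (H : nat -> 'M[C]_(m, n)) L (e : C) :
  0 < e -> entrywise_cvg \oo H L ->
  \forall k \near \oo, forall j, \sum_i `|(L - H k) i j| <= e.
Proof.
move=> e0 HL; have e'0 : 0 < e / m.+1%:R by rewrite divr_gt0.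
have : \forall k \near \oo, forall i j, `|L i j - H k i j| <= e / m.+1%:R.
  apply: filter_forall => i; apply: filter_forall => j.
  by have /cvgr_dist_le := HL i j; apply.
apply: filterS => k Hk j.
apply: (@le_trans _ _ (\sum_(i < m) e / m.+1%:R)).
  by apply: ler_sum => i _; rewrite !mxE.
rewrite sumr_const card_ord -[_ *+ m]mulr_natr -mulrA ler_piMr ?(ltW e0)//.
by rewrite mulrC ler_pdivrMr// mul1r ler_nat.
Qed.

Lemma contracting_recurrence_decay (n : nat) (T : 'M[C]_n) (r : C)
    (H L : nat -> 'M[C]_n) (v : nat -> 'cV[C]_n) :
  0 <= r < 1 -> (forall j, \sum_i `|T i j| <= r) ->
  entrywise_cvg \oo H 1%:M -> entrywise_cvg \oo L T ->
  (\forall k \near \oo, H k *m v k.+1 = L k *m v k) ->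
  exists c, exists2 t, 0 <= t < 1 & \forall k \near \oo, l1 (v k) <= c * t ^+ k.
Proof.
move=> /andP[r0 r1] Tr Hcvg Lcvg rec.
(* [t = (r + e) / (1 - e)], the contraction factor that remains when both [H k]
   and [L k] are [e]-close to their limits in the l1 operator norm. *)
pose e := (1 - r) / 4%:R.
have e0 : 0 < e by rewrite divr_gt0 ?subr_gt0.
pose t := (1 + 3%:R * r) / (3%:R + r).
have r3 : 0 < 3%:R + r by rewrite ltr_wpDr.
have r13 : 0 < 1 + 3%:R * r by rewrite ltr_wpDr// mulr_ge0.
have t0 : 0 < t by exact: divr_gt0.
have t1 : t < 1.
  rewrite /t ltr_pdivrMr// mul1r -subr_gt0.
  rewrite (_ : _ - _ = 2%:R * (1 - r)); last by ring.
  by rewrite mulr_gt0// subr_gt0.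
have step : \forall k \near \oo, l1 (v k.+1) <= t * l1 (v k).
  near=> k.
  have Hk : forall j, \sum_i `|(1%:M - H k) i j| <= e.
    by near: k; exact: near_column_sum_le.
  have Lk : forall j, \sum_i `|(T - L k) i j| <= e.
    by near: k; exact: near_column_sum_le.
  have Lk' j : \sum_i `|(L k) i j| <= r + e.
    apply: le_trans (lerD (Tr j) (Lk j)); rewrite -big_split/=.
    apply: ler_sum => i _; rewrite -{1}[L k i j](subKr (T i j)).
    by rewrite (le_trans (ler_normB _ _))// !mxE.
  have : l1 (v k.+1) <= (r + e) * l1 (v k) + e * l1 (v k.+1).
    have {1}-> : v k.+1 = L k *m v k + (1%:M - H k) *m v k.+1.
      have <- : H k *m v k.+1 = L k *m v k by near: k.
      by rewrite mulmxBl mul1mx addrC subrK.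
    by rewrite (le_trans (ler_l1D _ _))// lerD// ler_l1_mulmx.
  rewrite -lerBlDr -{1}[l1 (v k.+1)]mul1r -mulrBl.
  have -> : 1 - e = (3%:R + r) / 4%:R by rewrite /e; field.
  have -> : r + e = (1 + 3%:R * r) / 4%:R by rewrite /e; field.
  rewrite mulrAC [X in _ <= X]mulrAC ler_pM2r ?invr_gt0// => h.
  by rewrite /t mulrAC ler_pdivlMr// mulrC.
case: step => k0 _ step; exists (l1 (v k0) / t ^+ k0), t.
  by rewrite ltW.
exists k0 => // k /= /subnK <-; elim: (k - k0)%N => [|j IH].
  by rewrite add0n divfK// expf_neq0// gt_eqF.
rewrite addSn exprS mulrCA; apply: le_trans (step _ _) _; first exact: leq_addl.
by rewrite ler_pM2l.
Unshelve. all: by end_near. Qed.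

(** Conjugation to the basis in which [M] contracts the l1 norm reduces this to
    [contracting_recurrence_decay].  The factor [H k -> 1] keeps the recurrence
    implicit, so that it covers steps whose matrix is the inverse of a perturbed
    one. *)
Theorem recurrence_decay (n : nat) (M : 'M[C]_n) (H L : nat -> 'M[C]_n)
    (v : nat -> 'cV[C]_n) :
  (forall a, eigenvalue M a -> `|a| < 1) ->
  entrywise_cvg \oo H 1%:M -> entrywise_cvg \oo L M ->
  (\forall k \near \oo, H k *m v k.+1 = L k *m v k) ->
  exists c, exists2 t, 0 <= t < 1 & \forall k \near \oo, l1 (v k) <= c * t ^+ k.
Proof.
move=> Mlt1 Hcvg Lcvg rec.
have [P Punit [r r01 Tr]] := spectral_radius_lt1_contracting_basis Mlt1.
have conj_cvg A B : entrywise_cvg \oo A B ->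
    entrywise_cvg \oo (fun k => P *m A k *m invmx P) (P *m B *m invmx P).
  move=> AB; apply: entrywise_cvgM; last exact: entrywise_cvg_cst.
  by apply: entrywise_cvgM => //; exact: entrywise_cvg_cst.
have H1 : entrywise_cvg \oo (fun k => P *m H k *m invmx P) 1%:M.
  by have := conj_cvg _ _ Hcvg; rewrite mulmx1 mulmxV.
have := @contracting_recurrence_decay _ _ _ _ _ (fun k => P *m v k) r01 Tr H1
  (conj_cvg _ _ Lcvg).
case=> [|c [t t01 ct]].
  by apply: filterS rec => k rec; rewrite -!mulmxA !(mulKmx Punit) rec.
pose S := \sum_i \sum_j `|invmx P i j|.
have S0 : 0 <= S by apply: sumr_ge0 => i _; exact: sumr_ge0.
exists (S * c); exists t => //; apply: filterS ct => k ct.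
rewrite -[v k](mulKmx Punit) -mulrA.
apply: le_trans (ler_wpM2l S0 ct); apply: ler_l1_mulmx => j.
by apply: ler_sum => i _; rewrite (bigD1 j)//= lerDl sumr_ge0.
Qed.

End Contraction.

(** * Bilateral series *)

Section BilateralSeries.
Variable C : numClosedFieldType.

(** The sum of the half [n < 0] is written [l - a] so that linearity and shift
    invariance become statements on limits, with no sum to be extracted. *)
Definition bilateral_to (u : int -> C) (l : C) : Prop :=
  exists2 a, series (fun n : nat => u n%:Z) k @[k --> \oo] --> a &
             series (fun n : nat => u (- n.+1%:Z)) k @[k --> \oo] --> l - a.

Lemma bilateral_cvg_to (u : int -> C) :
  bilateral_cvg u -> bilateral_to u (bilateral_sum u).
Proof.
move=> [up um]; exists (limn (series (fun n : nat => u n%:Z))) => //.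
by rewrite /bilateral_sum addrC addKr.
Qed.

Lemma bilateral_to_sum (u : int -> C) l : bilateral_to u l -> bilateral_sum u = l.
Proof.
move=> [a ua la].
by rewrite /bilateral_sum (cvg_lim _ ua)// (cvg_lim _ la)// addrC subrK.
Qed.

Lemma bilateral_toD (u v : int -> C) l l' :
  bilateral_to u l -> bilateral_to v l' ->
  bilateral_to (fun n => u n + v n) (l + l').
Proof.
move=> [a ua la] [a' va' la']; exists (a + a').
  rewrite (_ : series _ =
    series (fun n : nat => u n%:Z) + series (fun n : nat => v n%:Z)).
    exact: cvgD.
  by rewrite -seriesD.
rewrite opprD addrACA.
rewrite (_ : series _ =
  series (fun n : nat => u (- n.+1%:Z)) + series (fun n : nat => v (- n.+1%:Z))).
  exact: cvgD.
by rewrite -seriesD.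
Qed.

Lemma bilateral_toZ (c : C) (u : int -> C) l :
  bilateral_to u l -> bilateral_to (fun n => c * u n) (c * l).
Proof.
move=> [a ua la]; exists (c * a).
  rewrite (_ : series _ = c *: series (fun n : nat => u n%:Z)); last by rewrite -seriesZ.
  exact: cvgZl_tmp.
rewrite -mulrBr (_ : series _ = c *: series (fun n : nat => u (- n.+1%:Z))).
  exact: cvgZl_tmp.
by rewrite -seriesZ.
Qed.

Lemma bilateral_to0 : bilateral_to (fun=> 0) 0.
Proof.
have s0 : series (fun=> 0 : C) = fun=> 0.
  by apply/funext => n; rewrite /series/= big1.
by exists 0; rewrite ?subr0 s0; exact: cvg_cst.
Qed.

Lemma bilateral_to_bigsum (I : Type) (s : seq I) (u : I -> int -> C) (l : I -> C) :
  (forall i, bilateral_to (u i) (l i)) ->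
  bilateral_to (fun n => \sum_(i <- s) u i n) (\sum_(i <- s) l i).
Proof.
move=> ul; elim: s => [|i s IH].
  by under eq_fun do rewrite big_nil; rewrite big_nil; exact: bilateral_to0.
under eq_fun do rewrite big_cons; rewrite big_cons.
exact: bilateral_toD.
Qed.

Lemma bilateral_to_shift (u : int -> C) l :
  bilateral_to u l -> bilateral_to (fun n => u (n + 1)) l.
Proof.
move=> [a ua la]; exists (a - u 0).
  rewrite (_ : series _ = fun k => series (fun n : nat => u n%:Z) k.+1 - u 0).
    apply: cvgB; last exact: cvg_cst.
    by have := ua; rewrite -cvg_shiftS.
  apply/funext => k; rewrite /series/= big_nat_recl// addrC addKr.
  by apply: eq_bigr => i _; rewrite -addn1 PoszD.
rewrite opprB addrCA -cvg_shiftS.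
rewrite (_ : [sequence _]_n = fun k => u 0 + series (fun n : nat => u (- n.+1%:Z)) k).
  by apply: cvgD => //; exact: cvg_cst.
apply/funext => k; rewrite /series/= big_nat_recl//; congr (_ + _).
by apply: eq_bigr => i _; rewrite -addn1 PoszD opprD subrK.
Qed.

Lemma bilateral_to_unique (u : int -> C) l l' :
  bilateral_to u l -> bilateral_to u l' -> l = l'.
Proof. by move=> /bilateral_to_sum <- /bilateral_to_sum <-. Qed.

Definition bilateral_vec_to (m : nat) (u : int -> 'cV[C]_m) (l : 'cV[C]_m) : Prop :=
  forall k, bilateral_to (fun n => u n k 0) (l k 0).

Lemma bilateral_vec_toZ (m : nat) c (u : int -> 'cV[C]_m) l :
  bilateral_vec_to u l -> bilateral_vec_to (fun n => c *: u n) (c *: l).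
Proof.
by move=> ul k; rewrite mxE; under eq_fun do rewrite mxE; exact: bilateral_toZ.
Qed.

Lemma bilateral_vec_toD (m : nat) (u v : int -> 'cV[C]_m) l l' :
  bilateral_vec_to u l -> bilateral_vec_to v l' ->
  bilateral_vec_to (fun n => u n + v n) (l + l').
Proof.
by move=> ul vl k; rewrite mxE; under eq_fun do rewrite mxE; exact: bilateral_toD.
Qed.

Lemma bilateral_vec_toB (m : nat) (u v : int -> 'cV[C]_m) l l' :
  bilateral_vec_to u l -> bilateral_vec_to v l' ->
  bilateral_vec_to (fun n => u n - v n) (l - l').
Proof.
move=> ul vl; rewrite -scaleN1r; under eq_fun do rewrite -scaleN1r.
by apply: bilateral_vec_toD => //; exact: bilateral_vec_toZ.
Qed.

Lemma bilateral_vec_to_mulmx (m p : nat) (A : 'M[C]_(p, m)) (u : int -> 'cV[C]_m) l :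
  bilateral_vec_to u l -> bilateral_vec_to (fun n => A *m u n) (A *m l).
Proof.
move=> ul k; rewrite mxE; under eq_fun do rewrite mxE.
by apply: bilateral_to_bigsum => j; exact: bilateral_toZ.
Qed.

Lemma bilateral_vec_to_bigsum (m : nat) (I : Type) (s : seq I)
    (u : I -> int -> 'cV[C]_m) (l : I -> 'cV[C]_m) :
  (forall i, bilateral_vec_to (u i) (l i)) ->
  bilateral_vec_to (fun n => \sum_(i <- s) u i n) (\sum_(i <- s) l i).
Proof.
move=> ul k; rewrite summxE; under eq_fun do rewrite summxE.
by apply: bilateral_to_bigsum => i; exact: ul.
Qed.

Lemma bilateral_vec_to_shift (m : nat) (u : int -> 'cV[C]_m) l :
  bilateral_vec_to u l -> bilateral_vec_to (fun n => u (n + 1)) l.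
Proof.
by move=> ul k; exact: (@bilateral_to_shift (fun n => u n k 0)).
Qed.

Lemma bilateral_vec_to_unique (m : nat) (u v : int -> 'cV[C]_m) l l' :
  (forall n, u n = v n) -> bilateral_vec_to u l -> bilateral_vec_to v l' -> l = l'.
Proof.
move=> uv ul vl; apply/colP => k; apply: (bilateral_to_unique (ul k)).
by under eq_fun do rewrite uv; exact: vl.
Qed.

Definition geometric_decay (u : nat -> C) : Prop :=
  exists c, exists2 t, 0 <= t < 1 & \forall k \near \oo, `|u k| <= c * t ^+ k.

(** Every bilateral series below decays geometrically at both ends, so this form
    of completeness carries all the convergence; it also forces the norm to be
    archimedean, see [geometric_cvg0]. *)
Definition geometrically_complete : Prop :=
  forall u, geometric_decay u -> cvgn (series u).

Lemma geometric_cvg0 (q : C) :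
  geometrically_complete -> `|q| < 1 -> q ^+ k @[k --> \oo] --> 0.
Proof.
move=> complete q1; apply: (@cvg_series_cvg_0 C C); apply: complete.
exists 1, `|q|; first by rewrite normr_ge0.
by near=> k; rewrite normrX mul1r.
Unshelve. all: by end_near. Qed.

End BilateralSeries.

(** * The complex numbers *)

Section Complex.
Variable R : realType.

Lemma real_geometric_series_cvg (u : nat -> R) :
  (exists c, exists2 t, 0 <= t < 1 & \forall k \near \oo, `|u k| <= c * t ^+ k) ->
  cvgn (series u).
Proof.
move=> [c [t /andP[t0 t1] [N _ uN]]].
rewrite -(is_cvg_series_restrict N).
suff : cvgn (series (fun k => u (k + N)%N)).
  move=> /cvg_ex[l ul]; apply/cvg_ex; exists l; rewrite -(cvg_shiftn N).
  rewrite (_ : [sequence _]_n = series (fun k => u (k + N)%N))//.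
  by apply/funext => n; rewrite /series/= -{1}[N]add0n big_addn addnK.
apply: normed_cvg.
have c0 : 0 <= c * t ^+ N by rewrite (le_trans _ (uN N _))/=.
apply: (@series_le_cvg _ _ (geometric (c * t ^+ N) t)) => [n|n|n|].
- exact: normr_ge0.
- exact: geometric_ge0.
- by rewrite /= -mulrA -exprD addnC; apply: uN => /=; exact: leq_addr.
- by apply: is_cvg_geometric_series; rewrite ger0_norm.
Qed.

Lemma ler_norm_ReD_Im (z : R[i]) :
  `|z| <= (`|complex.Re z| + `|complex.Im z|)%:C%C.
Proof.
rewrite normc_def lecR -[X in _ <= X]ger0_norm ?addr_ge0// -sqrtr_sqr.
rewrite ler_wsqrtr// sqrrD !real_normK ?num_real// lerD2r lerDl.
by rewrite mulrn_wge0// mulr_ge0.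
Qed.

Lemma Cplx_geometrically_complete : geometrically_complete (Cplx R).
Proof.
move=> u [c [t /andP[t0 t1] ut]].
have tE : t = (complex.Re t)%:C%C :> R[i] by rewrite RRe_real// ger0_real.
have t01 : 0 <= complex.Re t < 1.
  by move: t0 t1; rewrite tE lecE ltcE/= => /andP[_ ->] /andP[_ ->].
have bnd k : `|u k| <= c * t ^+ k :> Cplx R ->
    complex.Re (`|u k| : R[i]) <= complex.Re c * complex.Re t ^+ k.
  rewrite tE -rmorphXn/= => /[!lecE] /andP[_].
  by case: (c) => c1 c2 /=; rewrite mulr0 subr0.
have ReC : cvgn (series (fun k => complex.Re (u k))).
  apply: real_geometric_series_cvg; exists (complex.Re c), (complex.Re t) => //.
  apply: filterS ut => k /bnd; apply: le_trans.
  by have := normc_ge_Re (u k); rewrite lecE => /andP[_].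
have ImC : cvgn (series (fun k => complex.Im (u k))).
  apply: real_geometric_series_cvg; exists (complex.Re c), (complex.Re t) => //.
  apply: filterS ut => k /bnd; apply: le_trans.
  (* The imaginary part of [z] is, up to sign, the real part of ['i z]. *)
  have := normc_ge_Re (u k * 'i%C); rewrite lecE => /andP[_].
  rewrite normrM.
  case: (u k) => a b /=.
  by rewrite !(mul0r, mulr0, mulr1, add0r, sub0r, subr0, normrN, expr0n, expr1n,
    addr0, sqrtr1).
pose l : Cplx R := Complex (limn (series (fun k => complex.Re (u k))))
                           (limn (series (fun k => complex.Im (u k)))).
apply: (cvgP l); apply/cvgrPdist_le => e e0.
have eE : e = (complex.Re e)%:C%C :> R[i] by rewrite RRe_real// gtr0_real.
have e2 : 0 < complex.Re e / 2.
  by rewrite divr_gt0//; move: e0; rewrite ltcE => /andP[].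
near=> n; rewrite eE; apply: le_trans (ler_norm_ReD_Im _) _.
rewrite lecR (splitr (complex.Re e)).
have ReS : complex.Re (series u n) = series (fun k => complex.Re (u k)) n.
  by rewrite /series/= raddf_sum.
have ImS : complex.Im (series u n) = series (fun k => complex.Im (u k)) n.
  by rewrite /series/= raddf_sum.
rewrite lerD//.
- rewrite (_ : complex.Re _ = limn (series (fun k => complex.Re (u k))) -
      series (fun k => complex.Re (u k)) n); last by rewrite raddfB/= ReS.
  by near: n; move/cvgrPdist_le : ReC; apply.
- rewrite (_ : complex.Im _ = limn (series (fun k => complex.Im (u k))) -
      series (fun k => complex.Im (u k)) n); last by rewrite raddfB/= ImS.
  by near: n; move/cvgrPdist_le : ImC; apply.
Unshelve. all: by end_near. Qed.

Lemma cexpD (z w : Cplx R) : cexp (z + w) = cexp z * cexp w.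
Proof.
case: z w => [a b] [c d]; rewrite /cexp/= expRD cosD sinD.
by apply/eqP; rewrite eq_complex/=; apply/andP; split; apply/eqP; ring.
Qed.

Lemma cexp0 : cexp (0 : Cplx R) = 1.
Proof. by rewrite /cexp/= expR0 cos0 sin0 mulr1 mulr0. Qed.

Lemma qpowVN (logq a : Cplx R) : qpow logq a * qpow logq (- a) = 1.
Proof. by rewrite /qpow -cexpD mulNr subrr cexp0. Qed.

End Complex.

(** * The integral transformation *)

Section QTransform.
Variable C : numClosedFieldType.
Hypothesis complete : geometrically_complete C.
Variables (q ql : C).
Hypotheses (q_neq0 : q != 0) (q_lt1 : `|q| < 1) (ql_neq0 : ql != 0).
Variables (m N : nat) (B : 'I_N.+1 -> 'M[C]_m) (b : 'I_N.+1 -> C).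
Hypotheses (b0 : b ord0 = 0) (b_neq0 : forall i, i != ord0 -> b i != 0).
Variables (K : C -> C -> C) (domK : C -> C -> Prop).
Variables (Y : C -> 'cV[C]_m) (domY : C -> Prop).
Hypothesis K_shift_x : forall x s, domK (q * x) s -> domK x (s / q) ->
  ql * K (q * x) s = K x (s / q).
Hypothesis K_shift_s : forall x s, domK x s -> domK x (s / q) ->
  (x - s) * K x (s / q) = (x - ql * s) * K x s.
Hypothesis Y_sol : forall x, domY x -> domY (q * x) -> (forall i, x != b i) ->
  q_system_at q b B Y x.
Variable approach : C -> set_system C.
Hypothesis approach_proper : forall s, ProperFilter (approach s).
Hypothesis approach_nbhs : forall s, nbhs s `<=` approach s.
Hypothesis approach_scale : forall c s (P : set C), c != 0 ->
  approach (c * s) P -> approach s [set t | P (c * t)].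

Local Existing Instance approach_proper.

Local Notation wd x xi := (integrand_well_defined q b K domK Y domY approach x xi).

Definition regular x s := [/\ domK x s, domY s & forall i, s != b i].

(** The factor [s] is the weight of the Jackson integral, so that the terms of
    the latter are the values of [weighted] on the lattice. *)
Definition weighted x (i : 'I_N.+1) s : 'cV[C]_m := s *: integrand b K Y i x s.

Lemma regular_neq0 x s : regular x s -> s != 0.
Proof. by case=> _ _ /(_ ord0); rewrite b0. Qed.

Lemma weighted0 x s : s != 0 -> weighted x ord0 s = K x s *: Y s.
Proof. by move=> s0; rewrite /weighted /integrand scalerA b0 subr0 mulrC divfK. Qed.

Lemma weighted_proportional x j s : regular x s ->
  (s - b j) *: weighted x j s = s *: weighted x ord0 s.
Proof.
move=> gs; rewrite weighted0 ?(regular_neq0 gs)//.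
rewrite /weighted /integrand !scalerA; congr (_ *: _).
by field; rewrite subr_eq0; case: gs.
Qed.

(** [K(x, s)] times the equation of [Y] at [s]. *)
Lemma weighted_system x s : regular x s -> domY (q * s) ->
  K x s *: Y (q * s) = weighted x ord0 s - \sum_j B j *m weighted x j s.
Proof.
move=> gs dqs; have s0 := regular_neq0 gs; have [dK dY sb] := gs.
have := Y_sol dY dqs sb; rewrite /q_system_at => /(congr1 (fun u => (- s) *: u)).
rewrite scalerA mulfV ?oppr_eq0// scale1r => /eqP; rewrite subr_eq => /eqP ->.
rewrite weighted0// scalerDr addrC; congr (_ + _).
rewrite mulmx_suml !scaler_sumr -sumrN; apply: eq_bigr => j _.
rewrite /weighted /integrand -scalemxAl -!scalemxAr !scalerA -scaleNr.
congr (_ *: _).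
by rewrite mulrN mulNr mulrCA mulrA.
Qed.

(** The equation of [K] in its second variable, at [q s], turns [K(x, s) Y(q s)]
    into [W_0(x, q s)]: a recurrence along the lattice. *)
Lemma weighted_step x s : regular x s -> regular x (q * s) ->
  (x - ql * (q * s)) *: weighted x ord0 (q * s) =
  (x - q * s) *: (weighted x ord0 s - \sum_j B j *m weighted x j s).
Proof.
move=> gs gqs; rewrite weighted0 ?(regular_neq0 gqs)//.
have [dKq dYq _] := gqs; have [dK _ _] := gs.
rewrite -weighted_system// !scalerA; congr (_ *: _).
have qsq : q * s / q = s by rewrite mulrC mulKf.
by rewrite -K_shift_s// qsq.
Qed.

(** The equation of [K] in its first variable turns [K(x, s) Y(q s)] into
    [q^lambda W_0(q x, q s)]. *)
Lemma weighted_shift x s : regular x s -> regular x (q * s) ->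
  regular (q * x) (q * s) ->
  weighted x ord0 s - ql *: weighted (q * x) ord0 (q * s) =
  \sum_j B j *m weighted x j s.
Proof.
move=> gs gqs gqqs.
have [dKq dYq _] := gqs; have [dK _ _] := gs; have [dKqq _ _] := gqqs.
have qsq : q * s / q = s by rewrite mulrC mulKf.
rewrite (weighted0 _ (regular_neq0 gqs)) scalerA K_shift_x// ?qsq//.
by rewrite weighted_system// opprB addrC subrK.
Qed.

(** Splitting [x - b_i] as [(x - s) + (s - b_i)] removes the poles: the first
    summand is absorbed by the equations of [K], the second by [s - b_i]. *)
Lemma weighted_contiguity x i s : regular x s -> domK x (s / q) ->
  regular (q * x) s ->
  (x - b i) *: (weighted (q * x) i s - weighted x i s) =
  x *: weighted (q * x) ord0 s - (x / ql) *: weighted x ord0 s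
  + ((ql^-1 - 1) * x) *: weighted x i s.
Proof.
move=> gs dKs gqs; have s0 := regular_neq0 gs.
have [dK _ sb] := gs; have [dKq _ _] := gqs.
have E := K_shift_s dK dKs; rewrite -K_shift_x// in E.
rewrite !weighted0// /weighted /integrand !scalerA -scalerBl scalerA -scalerBl.
rewrite -scalerDl; congr (_ *: _); apply/eqP; rewrite -subr_eq0; apply/eqP.
(* The difference of the two sides is a multiple of [E], which must not be
   divided by [x - s]: the lattice may pass through [x]. *)
transitivity (b i / (ql * (s - b i)) *
  ((x - s) * (ql * K (q * x) s) - (x - ql * s) * K x s));
  last by rewrite E subrr mulr0.
by field; rewrite ql_neq0 subr_eq0 sb.
Qed.

Section Lattice.
Variables (x xi : C).
Hypothesis xi_neq0 : xi != 0.

Definition term_vec (i : 'I_N.+1) (n : int) : 'cV[C]_m :=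
  \col_k jackson_term q xi (integrand_value b K Y approach i x k) n.

Hypothesis x_xi_wd : wd x xi.

Lemma near_regular n : \forall s \near approach (q ^ n * xi), regular x s.
Proof. by have [] := x_xi_wd n. Qed.

Lemma lattice_succ n : q ^ (n + 1) * xi = q * (q ^ n * xi).
Proof. by rewrite expfzDr// expr1z mulrA [q * _]mulrC. Qed.

Lemma near_regular_succ n : \forall s \near approach (q ^ n * xi), regular x (q * s).
Proof.
by apply: approach_scale => //; rewrite -lattice_succ; exact: near_regular.
Qed.

Lemma near_domK_pred n : \forall s \near approach (q ^ n * xi), domK x (s / q).
Proof.
have : \forall s \near approach (q ^ n * xi), regular x (q^-1 * s).
  apply: approach_scale; first by rewrite invr_eq0.
  rewrite -[n](subrK 1) lattice_succ mulKf//; exact: near_regular.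
by apply: filterS => s []; rewrite mulrC.
Qed.

Lemma weighted_cvg i n :
  entrywise_cvg (approach (q ^ n * xi)) (weighted x i) (term_vec i n).
Proof.
move=> k j; rewrite ord1 mxE /jackson_term.
under eq_cvg do rewrite mxE.
apply: cvgM; first exact: approach_nbhs.
by have [_ /(_ i k)] := x_xi_wd n.
Qed.

Lemma weighted_cvg_succ i n :
  entrywise_cvg (approach (q ^ n * xi)) (fun s => weighted x i (q * s))
    (term_vec i (n + 1)).
Proof.
move=> k j; apply: (@cvg_comp _ _ _ (fun s => q * s) (fun s => weighted x i s k j)
  _ (approach (q ^ (n + 1) * xi))); last exact: weighted_cvg.
by move=> P; rewrite lattice_succ => /(approach_scale q_neq0).
Qed.

Lemma weighted_system_cvg n :
  entrywise_cvg (approach (q ^ n * xi)) (fun s => \sum_j B j *m weighted x j s)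
    (\sum_j B j *m term_vec j n).
Proof.
apply: entrywise_cvg_sum => j _; apply: entrywise_cvgM; last exact: weighted_cvg.
exact: entrywise_cvg_cst.
Qed.

Lemma term_vec_proportional j n :
  (q ^ n * xi - b j) *: term_vec j n = (q ^ n * xi) *: term_vec ord0 n.
Proof.
apply: (@entrywise_cvg_unique _ _ (approach (q ^ n * xi)) _ _ _
  (fun s => (s - b j) *: weighted x j s) (fun s => s *: weighted x ord0 s)).
- by apply: filterS (near_regular n) => s; exact: weighted_proportional.
- apply: (entrywise_cvgZ (a := fun s => s - b j) (H := weighted x j));
    last exact: weighted_cvg.
  by apply: cvgB; [exact: approach_nbhs|exact: cvg_cst].
- apply: (entrywise_cvgZ (a := id) (H := weighted x ord0)); last exact: weighted_cvg.
  exact: approach_nbhs.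
Qed.

Lemma term_vec_step n :
  (x - ql * (q * (q ^ n * xi))) *: term_vec ord0 (n + 1) =
  (x - q * (q ^ n * xi)) *:
    (term_vec ord0 n - \sum_j B j *m term_vec j n).
Proof.
have lin c : x - c * s @[s --> approach (q ^ n * xi)] --> x - c * (q ^ n * xi).
  apply: cvgB; first exact: cvg_cst.
  by apply: cvgM; [exact: cvg_cst|exact: approach_nbhs].
apply: (@entrywise_cvg_unique _ _ (approach (q ^ n * xi)) _ _ _
  (fun s => (x - ql * (q * s)) *: weighted x ord0 (q * s))
  (fun s => (x - q * s) *: (weighted x ord0 s - \sum_j B j *m weighted x j s))).
- near=> s; apply: weighted_step; near: s.
  + exact: near_regular.
  + exact: near_regular_succ.
- apply: (entrywise_cvgZ (a := fun s => x - ql * (q * s))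
      (H := fun s => weighted x ord0 (q * s))); last exact: weighted_cvg_succ.
  by rewrite mulrA; under eq_cvg do rewrite mulrA; exact: lin.
- apply: (entrywise_cvgZ (a := fun s => x - q * s)
      (H := fun s => weighted x ord0 s - \sum_j B j *m weighted x j s)).
    exact: lin.
  apply: entrywise_cvgB; [exact: weighted_cvg|exact: weighted_system_cvg].
Unshelve. all: by end_near. Qed.

(** * Geometric decay of the terms *)

Hypothesis x_neq0 : x != 0.

Lemma lattice_neq0 n : q ^ n * xi != 0.
Proof. by rewrite mulf_neq0// expfz_neq0. Qed.

Definition ratio j n := q ^ n * xi / (q ^ n * xi - b j).

Lemma term_vec_ratio j n : q ^ n * xi != b j ->
  term_vec j n = ratio j n *: term_vec ord0 n.
Proof.
move=> nb; rewrite /ratio mulrC -scalerA -(term_vec_proportional j) scalerA.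
rewrite mulVf ?scale1r//.
by rewrite subr_eq0.
Qed.

(** The components of the integrand differ from the zeroth one by the factors
    [ratio], which are bounded. *)
Lemma term_vec_decay (sigma : nat -> int) (l : 'I_N.+1 -> C) :
  (forall j, ratio j (sigma k) @[k --> \oo] --> l j) ->
  (forall j, \forall k \near \oo, q ^ sigma k * xi != b j) ->
  (exists c, exists2 t, 0 <= t < 1 &
    \forall k \near \oo, l1 (term_vec ord0 (sigma k)) <= c * t ^+ k) ->
  forall j i, geometric_decay (fun k => term_vec j (sigma k) i 0).
Proof.
move=> rl nb [c [t t01 ct]] j i.
pose M := `|l j| + 1; have M0 : 0 <= M by rewrite addr_ge0.
exists (M * c), t => //; near=> k.
rewrite term_vec_ratio; last by near: k; exact: nb.
rewrite mxE normrM -mulrA ler_pM//.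
  by near: k; apply: (cvgr_norm_le (l j)); [exact: rl|rewrite ltrDl].
by apply: le_trans (ler_norm_l1 _ _) _; near: k; exact: ct.
Unshelve. all: by end_near. Qed.

Lemma lattice_forward_cvg : q ^ k%:Z * xi @[k --> \oo] --> 0.
Proof.
rewrite -[X in _ --> X](mul0r xi); apply: cvgM; last exact: cvg_cst.
exact: geometric_cvg0.
Qed.

Lemma ratio_forward_cvg j : ratio j k%:Z @[k --> \oo] --> ((j == ord0)%:R : C).
Proof.
have [->|j0] := eqVneq j ord0.
  have -> : (fun k : nat => ratio ord0 k%:Z) = fun=> 1.
    by apply/funext => k; rewrite /ratio b0 subr0 mulfV// lattice_neq0.
  exact: cvg_cst.
have bj : 0 - b j != 0 by rewrite sub0r oppr_eq0 b_neq0.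
rewrite -[X in _ --> X](mul0r (0 - b j)^-1); apply: cvgM.
  exact: lattice_forward_cvg.
by apply: cvgV => //; apply: cvgB; [exact: lattice_forward_cvg|exact: cvg_cst].
Qed.

Lemma near_forward_neq j : \forall k \near \oo, q ^ k%:Z * xi != b j.
Proof.
have [->|j0] := eqVneq j ord0; first by rewrite b0; near=> k; exact: lattice_neq0.
have bj : 0 - b j != 0 by rewrite sub0r oppr_eq0 b_neq0.
have /(cvgr_neq0 (0 - b j)) : q ^ k%:Z * xi - b j @[k --> \oo] --> 0 - b j.
  by apply: cvgB; [exact: lattice_forward_cvg|exact: cvg_cst].
by move=> /(_ bj); apply: filterS => k; rewrite subr_eq0.
Unshelve. all: by end_near. Qed.

Lemma lattice_backward_cvg : (q ^ (- k.+1%:Z) * xi)^-1 @[k --> \oo] --> 0.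
Proof.
rewrite (_ : (fun k => _) = fun k => q ^+ k.+1 * xi^-1).
  rewrite -[X in _ --> X](mul0r xi^-1); apply: cvgM; last exact: cvg_cst.
  by have := geometric_cvg0 complete q_lt1; rewrite -cvg_shiftS.
by apply/funext => k; rewrite invfM -exprnN invrK.
Qed.

Lemma ratio_inv j n : ratio j n = (1 - b j * (q ^ n * xi)^-1)^-1.
Proof.
by rewrite /ratio -{1}(mulfV (lattice_neq0 n)) -mulrBl invf_div.
Qed.

Lemma backward_cvg1 j : 1 - b j * (q ^ (- k.+1%:Z) * xi)^-1 @[k --> \oo] --> (1 : C).
Proof.
have : 1 - b j * (q ^ (- k.+1%:Z) * xi)^-1 @[k --> \oo] --> (1 - b j * 0 : C).
  apply: cvgB; first exact: cvg_cst.
  by apply: cvgM; [exact: cvg_cst|exact: lattice_backward_cvg].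
by rewrite mulr0 subr0.
Qed.

Lemma ratio_backward_cvg j : ratio j (- k.+1%:Z) @[k --> \oo] --> (1 : C).
Proof.
under eq_cvg do rewrite ratio_inv.
have := cvgV (oner_neq0 _) (@backward_cvg1 j).
by rewrite invr1 => inv_cvg; exact: inv_cvg.
Qed.

Lemma near_backward_neq j : \forall k \near \oo, q ^ (- k.+1%:Z) * xi != b j.
Proof.
have /(cvgr_neq0 (1 : C)) /(_ (oner_neq0 _)) := @backward_cvg1 j.
apply: filterS => k; apply: contraNneq => <-.
by rewrite mulfV ?subrr// lattice_neq0.
Qed.

Hypothesis eig0 : forall a, eigenvalue (1%:M - B ord0) a -> `|a| < 1.
Hypothesis eigoo : forall a, eigenvalue (1%:M - \sum_i B i) a -> `|ql| < `|a|.

Lemma system_ratio_cvg (sigma : nat -> int) (l : 'I_N.+1 -> C) :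
  (forall j, ratio j (sigma k) @[k --> \oo] --> l j) ->
  entrywise_cvg \oo (fun k => 1%:M - \sum_j ratio j (sigma k) *: B j)
    (1%:M - \sum_j l j *: B j).
Proof.
move=> rl; apply: entrywise_cvgB; first exact: entrywise_cvg_cst.
apply: entrywise_cvg_sum => j _; apply: entrywise_cvgZ => //.
exact: entrywise_cvg_cst.
Qed.

Lemma term_vec_system n : (forall j, q ^ n * xi != b j) ->
  term_vec ord0 n - \sum_j B j *m term_vec j n =
  (1%:M - \sum_j ratio j n *: B j) *m term_vec ord0 n.
Proof.
move=> nb; rewrite mulmxBl mul1mx mulmx_suml; congr (_ - _).
by apply: eq_bigr => j _; rewrite term_vec_ratio// -scalemxAl -scalemxAr.
Qed.

(** Divided by [x], the recurrence tends to [v (k + 1) = (1 - B 0) v k] as the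
    lattice points tend to [0]. *)
Lemma forward_decay : exists c, exists2 t, 0 <= t < 1 &
  \forall k \near \oo, l1 (term_vec ord0 k%:Z) <= c * t ^+ k.
Proof.
pose lin c k := 1 - c * (q ^ k%:Z * xi) / x.
have lin1 c : lin c k @[k --> \oo] --> (1 : C).
  have : lin c k @[k --> \oo] --> (1 - c * 0 / x : C).
    apply: cvgB; first exact: cvg_cst.
    apply: cvgM; last exact: cvg_cst.
    by apply: cvgM; [exact: cvg_cst|exact: lattice_forward_cvg].
  by rewrite mulr0 mul0r subr0.
apply: (@recurrence_decay _ _ (1%:M - B ord0) (fun k => lin (ql * q) k *: 1%:M)
  (fun k => lin q k *: (1%:M - \sum_j ratio j k%:Z *: B j))) => //.
- rewrite -[1%:M]scale1r; apply: entrywise_cvgZ; first exact: lin1.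
  by rewrite scale1r; exact: entrywise_cvg_cst.
- rewrite -[1%:M - B ord0]scale1r; apply: entrywise_cvgZ; first exact: lin1.
  have -> : 1%:M - B ord0 = 1%:M - \sum_j (j == ord0)%:R *: B j.
    rewrite (bigD1 ord0)//= scale1r big1 ?addr0// => j /negbTE ->.
    by rewrite scale0r.
  by apply: system_ratio_cvg => j; exact: ratio_forward_cvg.
- near=> k.
  have nb j : q ^ k%:Z * xi != b j.
    by move: j; near: k; apply: filter_forall => j; exact: near_forward_neq.
  have xlin c : x^-1 * (x - c * (q ^ k%:Z * xi)) = lin c k.
    by rewrite mulrBr mulVf// [x^-1 * _]mulrC.
  rewrite -!scalemxAl mul1mx -term_vec_system// -!xlin -!scalerA -mulrA.
  by rewrite -term_vec_step -[k.+1]addn1 PoszD.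
Unshelve. all: by end_near. Qed.

(** An eigenvalue [0] would be of modulus at most [|ql|]. *)
Lemma system_oo_unit : 1%:M - \sum_i B i \in unitmx.
Proof.
rewrite -row_free_unit -kermx_eq0; apply/negPn/negP => k0.
suff /eigoo : eigenvalue (1%:M - \sum_i B i) 0 by rewrite normr0 normr_lt0.
by rewrite /eigenvalue /eigenspace /in_mem/= raddf0 subr0.
Qed.

(** Divided by the lattice point, the recurrence tends to
    [ql v k = (1 - sum B) v (k + 1)] as the lattice points tend to infinity.
    Step [k] goes from the lattice index [- (k + 1)] to [- (k + 2)], so it is
    [term_vec_step] at the latter. *)
Lemma backward_decay : exists c, exists2 t, 0 <= t < 1 &
  \forall k \near \oo, l1 (term_vec ord0 (- k.+1%:Z)) <= c * t ^+ k.
Proof.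
pose A := 1%:M - \sum_i B i.
pose z k := x * (q ^ (- k.+1%:Z) * xi)^-1.
have z0 : z k @[k --> \oo] --> 0.
  have : z k @[k --> \oo] --> (x * 0 : C).
    by apply: cvgM; [exact: cvg_cst|exact: lattice_backward_cvg].
  by rewrite mulr0.
have lin c : c - z k @[k --> \oo] --> c.
  have : c - z k @[k --> \oo] --> (c - 0 : C) by apply: cvgB => //; exact: cvg_cst.
  by rewrite subr0.
apply: (@recurrence_decay _ _ (ql *: invmx A)
  (fun k => (1 - z k) *: (invmx A *m (1%:M - \sum_j ratio j (- k.+2%:Z) *: B j)))
  (fun k => (ql - z k) *: invmx A)).
(* If [a] is an eigenvalue of [ql A^-1] then [ql / a] is one of [A]. *)
- move=> a /eigenvalueP[v va v0].
  have ql_v : ql *: v = a *: (v *m A).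
    by rewrite scalemxAl -va -scalemxAr -scalemxAl mulmxKV// system_oo_unit.
  have a0 : a != 0.
    apply: contraNneq v0 => a0; move: ql_v; rewrite a0 scale0r => /eqP.
    by rewrite scaler_eq0 (negbTE ql_neq0).
  have /eigoo : eigenvalue A (ql / a).
    apply/eigenvalueP; exists v => //.
    by rewrite mulrC -scalerA ql_v scalerA mulVf// scale1r.
  by rewrite normrM normfV ltr_pdivlMr ?normr_gt0// gtr_pMr ?normr_gt0.
- have AE : A = 1%:M - \sum_i 1 *: B i.
    by congr (_ - _); apply: eq_bigr => i _; rewrite scale1r.
  rewrite [X in entrywise_cvg _ _ X](_ : _ = 1 *: (invmx A *m A));
    last by rewrite mulVmx ?scale1r// system_oo_unit.
  apply: entrywise_cvgZ; first exact: lin.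
  apply: entrywise_cvgM; first exact: entrywise_cvg_cst.
  rewrite AE.
  apply: (@system_ratio_cvg (fun k => - k.+2%:Z) (fun=> 1)) => j.
  by have := @ratio_backward_cvg j; rewrite -cvg_shiftS.
- by apply: entrywise_cvgZ; [exact: lin|exact: entrywise_cvg_cst].
- near=> k.
  have nb j : q ^ (- k.+2%:Z) * xi != b j.
    move: j; near: k; apply: filter_forall => j.
    case: (near_backward_neq j) => M _ Mb; exists M => // k /= Mk.
    by apply: Mb => /=; exact: leqW.
  have succ : - k.+2%:Z + 1 = - k.+1%:Z :> int by rewrite -addn1 PoszD opprD subrK.
  have s0 := lattice_neq0 (- k.+1%:Z).
  have zE c : c - z k =
      - (q ^ (- k.+1%:Z) * xi)^-1 * (x - c * (q ^ (- k.+1%:Z) * xi)).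
    by rewrite /z; move: (q ^ _ * xi) s0 => s s0; field.
  have := term_vec_step (- k.+2%:Z); rewrite -lattice_succ succ => step.
  rewrite -!scalemxAl -mulmxA -term_vec_system// !scalemxAr.
  by rewrite [1 - z k]zE mul1r [ql - z k]zE -!scalerA step.
Unshelve. all: by end_near. Qed.

Lemma jackson_cvg_term i k : jackson_cvg q xi (integrand_value b K Y approach i x k).
Proof.
have termE n : jackson_term q xi (integrand_value b K Y approach i x k) n =
    term_vec i n k 0 by rewrite mxE.
split; apply: complete; under eq_fun do rewrite termE.
  apply: (@term_vec_decay (fun k => k%:Z)).
  - exact: ratio_forward_cvg.
  - exact: near_forward_neq.
  - exact: forward_decay.
apply: (@term_vec_decay (fun k => - k.+1%:Z) (fun=> 1)).
- exact: ratio_backward_cvg.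
- exact: near_backward_neq.
- exact: backward_decay.
Qed.

End Lattice.


(** * The system of the q-convolution *)

Section Equation.
Variables (x xi : C).
Hypotheses (x_neq0 : x != 0) (xi_neq0 : xi != 0).
Hypotheses (x_wd : wd x xi) (qx_wd : wd (q * x) xi).

Lemma term_vec_shift n :
  term_vec x xi ord0 n - ql *: term_vec (q * x) xi ord0 (n + 1) =
  \sum_j B j *m term_vec x xi j n.
Proof.
apply: (@entrywise_cvg_unique _ _ (approach (q ^ n * xi)) _ _ _
  (fun s => weighted x ord0 s - ql *: weighted (q * x) ord0 (q * s))
  (fun s => \sum_j B j *m weighted x j s)).
- near=> s; apply: weighted_shift; near: s.
  + exact: near_regular x_wd _.
  + exact: near_regular_succ x_wd _.
  + exact: near_regular_succ qx_wd _.
- apply: entrywise_cvgB; first exact: weighted_cvg x_wd _ _.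
  apply: (entrywise_cvgZ (a := fun=> ql)
    (H := fun s => weighted (q * x) ord0 (q * s))); first exact: cvg_cst.
  exact: weighted_cvg_succ qx_wd _ _.
- exact: weighted_system_cvg x_wd _.
Unshelve. all: by end_near. Qed.

Lemma term_vec_contiguity i n :
  (x - b i) *: (term_vec (q * x) xi i n - term_vec x xi i n) =
  x *: term_vec (q * x) xi ord0 n - (x / ql) *: term_vec x xi ord0 n
  + ((ql^-1 - 1) * x) *: term_vec x xi i n.
Proof.
have cvgZ c y j : wd y xi -> entrywise_cvg (approach (q ^ n * xi))
    (fun s => c *: weighted y j s) (c *: term_vec y xi j n).
  move=> y_wd; apply: (entrywise_cvgZ (a := fun=> c) (H := weighted y j)).
    exact: cvg_cst.
  exact: weighted_cvg.
apply: (@entrywise_cvg_unique _ _ (approach (q ^ n * xi)) _ _ _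
  (fun s => (x - b i) *: (weighted (q * x) i s - weighted x i s))
  (fun s => x *: weighted (q * x) ord0 s - (x / ql) *: weighted x ord0 s
            + ((ql^-1 - 1) * x) *: weighted x i s)).
- near=> s; apply: weighted_contiguity; near: s.
  + exact: near_regular x_wd _.
  + exact: near_domK_pred x_wd _.
  + exact: near_regular qx_wd _.
- rewrite scalerBr; under eq_fun do rewrite scalerBr.
  by apply: entrywise_cvgB; exact: cvgZ.
- apply: entrywise_cvgD; last exact: cvgZ.
  by apply: entrywise_cvgB; exact: cvgZ.
Unshelve. all: by end_near. Qed.

Variables S S' : 'I_N.+1 -> 'cV[C]_m.
Hypothesis S_sum : forall i, bilateral_vec_to (term_vec x xi i) (S i).
Hypothesis S'_sum : forall i, bilateral_vec_to (term_vec (q * x) xi i) (S' i).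

(** The sums of [W_0(q x, q s)] and of [W_0(q x, s)] over the lattice agree. *)
Lemma sum_shift : S ord0 - ql *: S' ord0 = \sum_j B j *m S j.
Proof.
apply: (bilateral_vec_to_unique term_vec_shift).
- apply: bilateral_vec_toB => //; apply: bilateral_vec_toZ.
  exact: bilateral_vec_to_shift.
- apply: bilateral_vec_to_bigsum => j; exact: bilateral_vec_to_mulmx.
Qed.

Lemma sum_contiguity i :
  (x - b i) *: (S' i - S i) =
  x *: S' ord0 - (x / ql) *: S ord0 + ((ql^-1 - 1) * x) *: S i.
Proof.
apply: (bilateral_vec_to_unique (term_vec_contiguity i)).
- by apply: bilateral_vec_toZ; exact: bilateral_vec_toB.
- apply: bilateral_vec_toD; last exact: bilateral_vec_toZ.
  by apply: bilateral_vec_toB; exact: bilateral_vec_toZ.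
Qed.

(** [sum_shift] eliminates [S' 0] from [sum_contiguity]. *)
Lemma sum_system i : x != b i ->
  (- x)^-1 *: (S' i - S i) =
  (x - b i)^-1 *: (ql^-1 *: (\sum_j B j *m S j) + (1 - ql^-1) *: S i).
Proof.
move=> xb; have xb0 : x - b i != 0 by rewrite subr_eq0.
rewrite -sum_shift; apply: (scalerI xb0).
rewrite scalerA mulrC -scalerA sum_contiguity [RHS]scalerA mulfV// scale1r.
rewrite scalerBr !scalerDr !scalerN !scalerA; congr (_ + _).
  rewrite addrC; congr (_ + _).
    rewrite -[- (_ *: S ord0)]scaleNr; congr (_ *: _).
    by field; rewrite ?oppr_eq0 ?x_neq0 ?ql_neq0.
  rewrite -[- (_ *: S' ord0)]scaleNr; congr (_ *: _).
  by field; rewrite ?oppr_eq0 ?x_neq0 ?ql_neq0.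
by congr (_ *: _); field; rewrite ?oppr_eq0 ?x_neq0 ?ql_neq0.
Qed.

End Equation.

(** The matrix [G_i] has the single block row [i], so that the [i]-th block of the
    system involves [G_i] alone. *)
Lemma q_convolution_system qml x (U U' : 'I_N.+1 -> 'cV[C]_m) :
  (forall i, (- x)^-1 *: (U' i - U i) =
    (x - b i)^-1 *: (qml *: (\sum_j B j *m U j) + (1 - qml) *: U i)) ->
  (- x)^-1 *: (\mxcol_(i < N.+1) U' i - \mxcol_(i < N.+1) U i) =
  (\sum_(i < N.+1) (x - b i)^-1 *: q_convolution qml B i) *m \mxcol_(i < N.+1) U i.
Proof.
move=> UU'.
pose X i := qml *: (\sum_j B j *m U j) + (1 - qml) *: U i.
have conv i : q_convolution qml B i *m \mxcol_(j < N.+1) U j =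
    \mxcol_(k < N.+1) (if k == i then X i else 0).
  rewrite /q_convolution mul_mxblock_mxrow; apply: eq_mxcol => k.
  case: eqP => _; last by rewrite big1// => j _; rewrite mul0mx.
  rewrite (bigD1 i)//= eqxx mulmxDl mul_scalar_mx -scalemxAl addrAC; congr (_ + _).
  rewrite [in RHS](bigD1 i)//= scalerDr scaler_sumr; congr (_ + _).
  by apply: eq_bigr => j /negbTE ->; rewrite -scalemxAl.
rewrite mulmx_suml.
transitivity (\sum_(i < N.+1) (x - b i)^-1 *:
    \mxcol_(k < N.+1) (if k == i then X i else 0)); last first.
  by apply: eq_bigr => i _; rewrite -scalemxAl conv.
apply/matrixP => r c; rewrite summxE.
pose k := tagnat.sig1 r.
rewrite [RHS](bigD1 k)//= [X in _ = _ + X]big1 ?addr0; last first.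
  by move=> i /negbTE ik; rewrite !mxE eq_sym ik mxE mulr0.
have := congr1 (fun A : 'cV_m => A (tagnat.sig2 r) c) (UU' k).
by rewrite !mxE eqxx !mxE.
Qed.

Hypothesis eig0 : forall a, eigenvalue (1%:M - B ord0) a -> `|a| < 1.
Hypothesis eigoo : forall a, eigenvalue (1%:M - \sum_i B i) a -> `|ql| < `|a|.

Definition sum_vec x xi i : 'cV[C]_m :=
  \col_k bilateral_sum (jackson_term q xi (integrand_value b K Y approach i x k)).

Lemma sum_vecP x xi i : x != 0 -> xi != 0 -> wd x xi ->
  bilateral_vec_to (term_vec x xi i) (sum_vec x xi i).
Proof.
move=> x0 xi0 x_wd k; rewrite mxE; under eq_fun do rewrite mxE.
by apply: bilateral_cvg_to; exact: jackson_cvg_term.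
Qed.

Lemma q_transform_sum_vec x xi : q_transform q b K Y approach x xi =
  \mxcol_(i < N.+1) ((1 - q) *: sum_vec x xi i).
Proof. by apply: eq_mxcol => i; apply/colP => k; rewrite !mxE. Qed.

Lemma q_transform_converges x xi : x != 0 -> xi != 0 -> wd x xi ->
  q_transform_cvg q b K Y approach x xi.
Proof. by move=> x0 xi0 x_wd i k; exact: jackson_cvg_term. Qed.

(** [xi] and [q xi] generate the same lattice, with indices shifted by one; the
    case of [xi] proportional to [x] thus reduces to that of a fixed lattice. *)
Lemma lattice_shift_wd x xi : wd x (q * xi) -> wd x xi.
Proof.
move=> x_wd n; have := x_wd (n - 1).
by rewrite [q ^ _ * (q * xi)]mulrCA -lattice_succ subrK.
Qed.

Lemma sum_vec_lattice_shift x xi i : x != 0 -> xi != 0 -> wd x xi ->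
  sum_vec x (q * xi) i = sum_vec x xi i.
Proof.
move=> x0 xi0 x_wd; apply/colP => k; rewrite !mxE; apply: bilateral_to_sum.
have := bilateral_vec_to_shift (sum_vecP i x0 xi0 x_wd) k; rewrite mxE.
congr bilateral_to; apply/funext => n.
by rewrite mxE /jackson_term lattice_succ mulrCA.
Qed.

Lemma q_transform_system x xi xi' : (forall i, x != b i) -> xi != 0 ->
  xi' = xi \/ xi' = q * xi -> wd x xi -> wd (q * x) xi' ->
  (- x)^-1 *: (q_transform q b K Y approach (q * x) xi' -
               q_transform q b K Y approach x xi) =
  (\sum_(i < N.+1) (x - b i)^-1 *: q_convolution ql^-1 B i) *m
    q_transform q b K Y approach x xi.
Proof.
move=> xb xi0 xi'E x_wd qx_wd'.
have x0 : x != 0 by rewrite -b0.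
have qx0 : q * x != 0 by rewrite mulf_neq0.
have qx_wd : wd (q * x) xi by case: xi'E qx_wd' => -> // /lattice_shift_wd.
have sum' i : sum_vec (q * x) xi' i = sum_vec (q * x) xi i.
  by case: xi'E => -> //; exact: sum_vec_lattice_shift.
rewrite !q_transform_sum_vec; apply: q_convolution_system => i.
have sys : (- x)^-1 *: (sum_vec (q * x) xi i - sum_vec x xi i) =
    (x - b i)^-1 *: (ql^-1 *: (\sum_j B j *m sum_vec x xi j)
                     + (1 - ql^-1) *: sum_vec x xi i).
  by apply: (sum_system x0 x_wd qx_wd) => // j; exact: sum_vecP.
transitivity ((1 - q) *: ((- x)^-1 *: (sum_vec (q * x) xi i - sum_vec x xi i))).
  by rewrite sum' -scalerBr !scalerA [in LHS]mulrC.
rewrite sys.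
rewrite [LHS]scalerA [_ * (x - b i)^-1]mulrC -[LHS]scalerA; congr (_ *: _).
rewrite scalerDr !scalerA ![(1 - q) * _]mulrC -!scalerA; congr (_ *: _ + _).
by rewrite scaler_sumr; apply: eq_bigr => j _; rewrite scalemxAr.
Qed.

End QTransform.

(** * The two evaluation filters *)

Section Approach.
Variables (C : numClosedFieldType) (approach : C -> set_system C).
Hypothesis approachE : approach = principal_filter \/ approach = dnbhs.

Lemma evaluation_proper s : ProperFilter (approach s).
Proof.
case: approachE => ->; first exact: principal_filter_proper.
exact: Proper_dnbhs_numFieldType.
Qed.

Lemma evaluation_nbhs s : nbhs s `<=` approach s.
Proof.
case: approachE => -> P Ps; last exact: nbhs_dnbhs.
by apply/principal_filterP; exact: nbhs_singleton.
Qed.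

Lemma evaluation_scale c s (P : set C) : c != 0 ->
  approach (c * s) P -> approach s [set t | P (c * t)].
Proof.
move=> c0; case: approachE => ->.
  by move=> /principal_filterP Ps; exact/principal_filterP.
rewrite /dnbhs /within /= => Ps.
have : c * t @[t --> s] --> c * s by exact: mulrl_continuous.
move=> /(_ _ Ps); rewrite nbhs_simpl /=; apply: filterS => t /= h ts; apply: h.
by apply: contra_neq ts => /(mulfI c0).
Qed.

End Approach.

Unset Implicit Arguments.
Set Strict Implicit.

Theorem theorem3p8 (R : realType) (q logq lambda : Cplx R) (m N : nat)
    (B : 'I_N.+1 -> 'M[Cplx R]_m) (b : 'I_N.+1 -> Cplx R)
    (K : Cplx R -> Cplx R -> Cplx R) (domK : Cplx R -> Cplx R -> Prop)
    (Y : Cplx R -> 'cV[Cplx R]_m) (domY : Cplx R -> Prop)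
    (xi : Cplx R -> Cplx R) (approach : Cplx R -> set_system (Cplx R))
    (q_gt0 : 0 < `|q|) (q_lt1 : `|q| < 1) (logqE : cexp logq = q)
    (b0 : b ord0 = 0) (b_neq0 : forall i, i != ord0 -> b i != 0)
    (b_inj : forall i j, i != ord0 -> j != ord0 -> i != j -> b i != b j)
    (* Each functional equation is assumed where both of its sides are defined;
       the second one has its denominator [x - s] cleared, so that it keeps
       its meaning on the diagonal [s = x]. *)
    (K_shift_x : forall x s, domK (q * x) s -> domK x (s / q) ->
       qpow logq lambda * K (q * x) s = K x (s / q))
    (K_shift_s : forall x s, domK x s -> domK x (s / q) ->
       (x - s) * K x (s / q) = (x - qpow logq lambda * s) * K x s)
    (Y_sol : forall x, domY x -> domY (q * x) -> (forall i, x != b i) ->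
       q_system_at q b B Y x)
    (xiE : (exists2 c, c != 0 & forall x, xi x = c) \/
           (exists2 A, A != 0 & forall x, xi x = A * x))
    (approachE : approach = principal_filter \/ approach = dnbhs)
    (eig0 : forall a, eigenvalue (1%:M - B ord0) a -> `|a| < 1)
    (eigoo : forall a, eigenvalue (1%:M - \sum_(i < N.+1) B i) a ->
       `|a| > `|qpow logq lambda|) :
  (forall x, x != 0 ->
     integrand_well_defined q b K domK Y domY approach x (xi x) ->
     q_transform_cvg q b K Y approach x (xi x)) /\
  (forall x, (forall i, x != b i) ->
     integrand_well_defined q b K domK Y domY approach x (xi x) ->
     integrand_well_defined q b K domK Y domY approach (q * x) (xi (q * x)) ->
     q_system_at q b (q_convolution (qpow logq (- lambda)) B)
       (fun z => q_transform q b K Y approach z (xi z)) x).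

Proof.
have q0 : q != 0 by rewrite -normr_gt0.
have qlV := qpowVN logq lambda.
have ql0 : qpow logq lambda != 0.
  by apply: contra_eq_neq qlV => ->; rewrite mul0r eq_sym oner_neq0.
have qlE : qpow logq (- lambda) = (qpow logq lambda)^-1.
  by apply: (mulfI ql0); rewrite qlV mulfV.
have xi0 x : x != 0 -> xi x != 0.
  by case: xiE => [[c c0 ->]//|[A A0 ->] x0]; rewrite mulf_neq0.
have xi_succ x : xi (q * x) = xi x \/ xi (q * x) = q * xi x.
  case: xiE => [[c _ xic]|[A _ xiA]]; first by left; rewrite !xic.
  by right; rewrite !xiA mulrCA.
have proper := evaluation_proper approachE.
have complete := @Cplx_geometrically_complete R.
split=> [x x0 x_wd|x xb x_wd qx_wd].
  apply: (q_transform_converges complete q0 q_lt1 ql0 b0 b_neq0 K_shift_s Y_sol proper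
    (evaluation_nbhs approachE) (evaluation_scale approachE) eig0 eigoo x0 _ x_wd).
  exact: xi0.
rewrite qlE; apply: (q_transform_system complete q0 q_lt1 ql0 b0 b_neq0 K_shift_x
  K_shift_s Y_sol proper
  (evaluation_nbhs approachE) (evaluation_scale approachE) eig0 eigoo xb _ _
  x_wd qx_wd).
- by apply: xi0; rewrite -b0.
- exact: xi_succ.
Qed.
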